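(* Let $(b_\nu)_{\nu\in\mathbb{Z}_{\ge 0}^2}$ be a family of quaternions and let $$\sigma=\limsup_{n\to\infty}\Bigl(\sum_{s=0}^n\binom{n}{s}\Bigl\|\frac{b_{(s,n-s)}}{n!}\Bigr\|\Bigr)^{1/n}.$$ Then the series $$g(x)=\sum_{n=0}^\infty\ \sum_{\substack{\nu=(s,t)\\ s+t=n}} S_\nu(x)\, b_\nu$$ converges compactly on $\{x\in\mathbb{V} : \|x\|_1'<\tfrac1\sigma\}$.
   Context: $\mathbb{H}$ denotes the quaternions with imaginary units $i,j,k$ ($i^2=j^2=k^2=ijk=-1$) and Euclidean norm $\|\cdot\|$; $\mathbb{V}\subset\mathbb{H}$ is the real vector space spanned by $i,j,k$, with elements $v=iv_1+jv_2+kv_3$, $v_1,v_2,v_3\in\mathbb{R}$. Define $\xi_2,\xi_3:\mathbb{V}\to\mathbb{H}$ by $\xi_2(v)=v_2-i^{-1}j\,v_1$ and $\xi_3(v)=v_3-i^{-1}k\,v_1$. For $\nu=(s,t)\in\mathbb{Z}_{\ge0}^2$ put $\|\nu\|=s+t=n$, let $B_\nu$ be the set of all words $(i_1,\dots,i_n)$ with exactly $s$ letters $2$ and $t$ letters $3$, and define $$S_\nu(v)=\frac1{n!}\sum_{(i_1,\dots,i_n)\in B_\nu}\xi_{i_1}(v)\cdots\xi_{i_n}(v)$$ (the product over the empty word is $1$). The auxiliary norm on $\mathbb{V}$ is $\|iv_1+jv_2+kv_3\|_1'=\max\{\|v_2-i^{-1}jv_1\|,\|v_3-i^{-1}kv_1\|\}$.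 Conventions: $1/\sigma=\infty$ if $\sigma=0$ (the set is then all of $\mathbb{V}$) and $1/\sigma=0$ if $\sigma=\infty$ (the set is then empty). A series $\sum_n\sum_{\|\nu\|=n}S_\nu b_\nu$ converges compactly on an open set if its partial sums over $n\le N$ converge, as $N\to\infty$, uniformly on every compact subset of that set. *)

(* Defs.v *)
From HB Require Import structures.
From mathcomp Require Import all_boot all_order all_algebra.
From mathcomp Require Import ring lra.
From mathcomp Require Import all_classical all_reals all_analysis.
Set Implicit Arguments.
Unset Strict Implicit.
Unset Printing Implicit Defensive.
Import Order.TTheory GRing.Theory Num.Theory.
Import numFieldNormedType.Exports.

Local Open Scope classical_set_scope.
Local Open Scope ring_scope.

(* Quat a b c d is a + b i + c j + d k. *)
Record quat (R : Type) := Quat { q0 : R; q1 : R; q2 : R; q3 : R }.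

Section QuatChoice.
Variable R : Type.

Definition tuple_of_quat (x : quat R) := (q0 x, q1 x, q2 x, q3 x).
Definition quat_of_tuple (x : R * R * R * R) :=
  let: (a, b, c, d) := x in Quat a b c d.

Lemma tuple_of_quatK : cancel tuple_of_quat quat_of_tuple.
Proof. by case. Qed.

End QuatChoice.

HB.instance Definition _ (R : eqType) :=
  Equality.copy (quat R) (can_type (@tuple_of_quatK R)).
HB.instance Definition _ (R : choiceType) :=
  Choice.copy (quat R) (can_type (@tuple_of_quatK R)).

Section QuatAlgebra.
Variable R : realType.
Implicit Types x y z : quat R.

Definition quat_add x y :=
  Quat (q0 x + q0 y) (q1 x + q1 y) (q2 x + q2 y) (q3 x + q3 y).
Definition quat_opp x := Quat (- q0 x) (- q1 x) (- q2 x) (- q3 x).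
Definition quat_scale (a : R) x :=
  Quat (a * q0 x) (a * q1 x) (a * q2 x) (a * q3 x).
Definition quat_mul x y := Quat
  (q0 x * q0 y - q1 x * q1 y - q2 x * q2 y - q3 x * q3 y)
  (q0 x * q1 y + q1 x * q0 y + q2 x * q3 y - q3 x * q2 y)
  (q0 x * q2 y - q1 x * q3 y + q2 x * q0 y + q3 x * q1 y)
  (q0 x * q3 y + q1 x * q2 y - q2 x * q1 y + q3 x * q0 y).
Definition quat_sqnorm x := q0 x ^+ 2 + q1 x ^+ 2 + q2 x ^+ 2 + q3 x ^+ 2.
Definition quat_inv x := quat_scale (quat_sqnorm x)^-1
  (Quat (q0 x) (- q1 x) (- q2 x) (- q3 x)).
Definition quat_norm x := Num.sqrt (quat_sqnorm x).

Let zeroq : quat R := Quat 0 0 0 0.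
Let oneq : quat R := Quat 1 0 0 0.

Let addqA : associative quat_add.
Proof. by case=> ? ? ? ? [? ? ? ?] [? ? ? ?]; rewrite /quat_add /= !addrA. Qed.
Let addqC : commutative quat_add.
Proof.
move=> [a b c d] [a' b' c' d']; rewrite /quat_add /=.
by congr Quat; rewrite addrC.
Qed.
Let add0q : left_id zeroq quat_add.
Proof. by case=> ? ? ? ?; rewrite /quat_add /= !add0r. Qed.
Let addNq : left_inverse zeroq quat_opp quat_add.
Proof. by case=> ? ? ? ?; rewrite /quat_add /= !addNr. Qed.

HB.instance Definition _ := GRing.isZmodule.Build (quat R)
  addqA addqC add0q addNq.

Let mulqA : associative quat_mul.
Proof.
by case=> ? ? ? ? [? ? ? ?] [? ? ? ?]; rewrite /quat_mul /=; congr Quat; ring.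
Qed.
Let mul1q : left_id oneq quat_mul.
Proof. by case=> ? ? ? ?; rewrite /quat_mul /=; congr Quat; ring. Qed.
Let mulq1 : right_id oneq quat_mul.
Proof. by case=> ? ? ? ?; rewrite /quat_mul /=; congr Quat; ring. Qed.
Let mulqDl : left_distributive quat_mul quat_add.
Proof.
case=> ? ? ? ? [? ? ? ?] [? ? ? ?]; rewrite /quat_mul /quat_add /=.
by congr Quat; ring.
Qed.
Let mulqDr : right_distributive quat_mul quat_add.
Proof.
case=> ? ? ? ? [? ? ? ?] [? ? ? ?]; rewrite /quat_mul /quat_add /=.
by congr Quat; ring.
Qed.
Let oneq_neq0 : oneq != zeroq.
Proof. by apply/eqP => -[] /eqP; rewrite oner_eq0. Qed.

HB.instance Definition _ := GRing.Zmodule_isNzRing.Build (quat R)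
  mulqA mul1q mulq1 mulqDl mulqDr oneq_neq0.

Let scaleqA (a b : R) x : quat_scale a (quat_scale b x) = quat_scale (a * b) x.
Proof. by rewrite /quat_scale /= !mulrA. Qed.
Let scale1q : left_id 1 quat_scale.
Proof. by case=> ? ? ? ?; rewrite /quat_scale /= !mul1r. Qed.
Let scaleqDr : right_distributive quat_scale +%R.
Proof. by move=> a [? ? ? ?] [? ? ? ?]; rewrite /quat_scale /= !mulrDr. Qed.
Let scaleqDl x : {morph quat_scale^~ x : a b / a + b}.
Proof. by move=> a b; rewrite /quat_scale /= !mulrDl. Qed.

HB.instance Definition _ := GRing.Zmodule_isLmodule.Build R (quat R)
  scaleqA scale1q scaleqDr scaleqDl.

Let scaleqAl (a : R) x y : a *: (x * y) = (a *: x) * y.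
Proof.
case: x y => ? ? ? ? [? ? ? ?].
rewrite /GRing.scale /GRing.mul /= /quat_scale /quat_mul /=.
by congr Quat; ring.
Qed.

HB.instance Definition _ := GRing.Lmodule_isLalgebra.Build R (quat R) scaleqAl.

Let scaleqAr (a : R) x y : a *: (x * y) = x * (a *: y).
Proof.
case: x y => ? ? ? ? [? ? ? ?].
rewrite /GRing.scale /GRing.mul /= /quat_scale /quat_mul /=.
by congr Quat; ring.
Qed.

HB.instance Definition _ := GRing.Lalgebra_isAlgebra.Build R (quat R) scaleqAr.

Lemma quat_sqnorm_ge0 x : 0 <= quat_sqnorm x.
Proof. by rewrite /quat_sqnorm !addr_ge0 ?sqr_ge0. Qed.

Lemma quat_sqnorm_eq0 x : (quat_sqnorm x == 0) = (x == 0).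
Proof.
apply/idP/eqP => [|->]; last by rewrite /quat_sqnorm /= !expr0n /= !addr0.
rewrite /quat_sqnorm !paddr_eq0 ?addr_ge0 ?sqr_ge0// !sqrf_eq0.
by case: x => a b c d /= /andP[/andP[/andP[/eqP-> /eqP->] /eqP->] /eqP->].
Qed.

Let mulVq : {in [pred x | x != 0], left_inverse 1 quat_inv *%R}.
Proof.
move=> x; rewrite inE -quat_sqnorm_eq0 => x0.
case: x x0 => a b c d x0.
rewrite /GRing.mul /= /quat_inv /quat_mul /quat_scale /=.
by rewrite /quat_sqnorm /= in x0 *; congr Quat; field.
Qed.

Let mulqV : {in [pred x | x != 0], right_inverse 1 quat_inv *%R}.
Proof.
move=> x; rewrite inE -quat_sqnorm_eq0 => x0.
case: x x0 => a b c d x0.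
rewrite /GRing.mul /= /quat_inv /quat_mul /quat_scale /=.
by rewrite /quat_sqnorm /= in x0 *; congr Quat; field.
Qed.

Let unitqP x y : y * x = 1 /\ x * y = 1 -> [pred x | x != 0] x.
Proof.
move=> [yx1 _] /=; apply/eqP => x0.
by move: yx1; rewrite x0 mulr0 => /eqP; rewrite eq_sym oner_eq0.
Qed.

Let invq_out : {in [predC [pred x | x != 0]], quat_inv =1 id}.
Proof.
move=> x; rewrite !inE negbK => /eqP ->.
by rewrite /quat_inv /quat_scale /= oppr0 !mulr0.
Qed.

HB.instance Definition _ := GRing.NzRing_hasMulInverse.Build (quat R)
  mulVq mulqV unitqP invq_out.

Let quat_dot x y := q0 x * q0 y + q1 x * q1 y + q2 x * q2 y + q3 x * q3 y.

Let dotq_le x y : quat_dot x y <= quat_norm x * quat_norm y.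
Proof.
rewrite -sqrtrM ?quat_sqnorm_ge0//.
apply: le_trans (ler_norm _) _; rewrite -sqrtr_sqr.
apply: ler_wsqrtr; rewrite -subr_ge0.
case: x y => a b c d [a' b' c' d']; rewrite /quat_sqnorm /quat_dot /=.
rewrite (_ : _ - _ = (a * b' - b * a') ^+ 2 + (a * c' - c * a') ^+ 2
  + (a * d' - d * a') ^+ 2 + (b * c' - c * b') ^+ 2
  + (b * d' - d * b') ^+ 2 + (c * d' - d * c') ^+ 2); last by ring.
by rewrite !addr_ge0 ?sqr_ge0.
Qed.

Let normqD x y : quat_norm (x + y) <= quat_norm x + quat_norm y.
Proof.
rewrite -[leRHS]ger0_norm ?addr_ge0 ?sqrtr_ge0// -sqrtr_sqr ler_wsqrtr//.
rewrite sqrrD !sqr_sqrtr ?quat_sqnorm_ge0//.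
rewrite (_ : quat_sqnorm _ =
  quat_sqnorm x + quat_dot x y *+ 2 + quat_sqnorm y); last first.
  by rewrite /quat_sqnorm /quat_dot /=; ring.
by rewrite lerD2r lerD2l lerMn2r dotq_le orbT.
Qed.

Let normqZ (a : R) x : quat_norm (a *: x) = `|a| * quat_norm x.
Proof.
rewrite -sqrtr_sqr -sqrtrM ?sqr_ge0//; congr Num.sqrt.
by rewrite /quat_sqnorm /=; ring.
Qed.

Let normq0_eq0 x : quat_norm x = 0 -> x = 0.
Proof.
move=> /eqP; rewrite sqrtr_eq0 => x0; apply/eqP.
by rewrite -quat_sqnorm_eq0 eq_le x0 quat_sqnorm_ge0.
Qed.

HB.instance Definition _ := Lmodule_isNormed.Build R (quat R)
  normqD normqZ normq0_eq0.

Definition qi : quat R := Quat 0 1 0 0.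
Definition qj : quat R := Quat 0 0 1 0.
Definition qk : quat R := Quat 0 0 0 1.

Lemma quat_relations :
  [/\ qi ^+ 2 = -1, qj ^+ 2 = -1, qk ^+ 2 = -1 & qi * qj * qk = -1].
Proof.
by split; rewrite ?expr2 /GRing.mul /= /quat_mul /=; congr Quat => /=; ring.
Qed.

Lemma quat_normE x :
  `|x| = Num.sqrt (q0 x ^+ 2 + q1 x ^+ 2 + q2 x ^+ 2 + q3 x ^+ 2).
Proof. by []. Qed.

End QuatAlgebra.

Arguments qi {R}.
Arguments qj {R}.
Arguments qk {R}.

Section FueterSeries.
Variable R : realType.
Implicit Types v x : quat R.

(* The real span of i, j, k, as a subset of the quaternions; its compact subsets
   are those of the ambient space. *)
Definition imq : set (quat R) :=
  [set v | exists v1 v2 v3 : R,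
    v = qi * v1%:A + qj * v2%:A + qk * v3%:A].

Definition xi2 v : quat R := (q2 v)%:A - qi^-1 * qj * (q1 v)%:A.
Definition xi3 v : quat R := (q3 v)%:A - qi^-1 * qk * (q1 v)%:A.

(* The letters 2 and 3 are encoded as false and true. *)
Definition xi (l : bool) : quat R -> quat R := if l then xi3 else xi2.

Definition words (s t : nat) : {set (s + t).-tuple bool} :=
  [set w : (s + t).-tuple bool |
    (count_mem false w == s) && (count_mem true w == t)]%SET.

Definition Snu (s t : nat) v : quat R :=
  ((s + t)`!%:R)^-1 *: \sum_(w in words s t) \prod_(l <- w) xi l v.

Definition norm1' v : R := Num.max `|xi2 v| `|xi3 v|.

Definition sigma (b : nat -> nat -> quat R) : \bar R :=
  limn_esup (fun n => ((\sum_(s < n.+1)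
    'C(n, s)%:R * `|(n`!%:R)^-1 *: b s (n - s)%N|) `^ n%:R^-1)%:E).

(* On \bar R the library inverse satisfies 0^-1 = +oo and +oo^-1 = 0. *)
Definition convergence_set (b : nat -> nat -> quat R) : set (quat R) :=
  [set x | imq x /\ ((norm1' x)%:E < (sigma b)^-1)%E].

Definition partial_sum (b : nat -> nat -> quat R) (N : nat) x : quat R :=
  \sum_(n < N.+1) \sum_(s < n.+1) Snu s (n - s)%N x * b s (n - s)%N.

End FueterSeries.

(* Main.v *)
(* The quaternion norm is multiplicative, so each word of length n in the xi_l(x)
   has norm at most ||x||_1'^n; as there are 'C(n, s) words with s letters 2, the
   n-th homogeneous term of the series is bounded by a_n ||x||_1'^n, where
   a_n is the sum whose n-th root defines sigma.  On a nonempty compact set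
   ||.||_1' attains a maximum r < 1/sigma; for sigma < rho < 1/r one has
   a_n <= C rho^n, and the Weierstrass M-test with the geometric series
   C (r rho)^n applies. *)
Require Import Defs.
From HB Require Import structures.
From mathcomp Require Import all_boot all_order all_algebra.
From mathcomp Require Import ring lra.
From mathcomp Require Import all_classical all_reals all_analysis.
Import Order.TTheory GRing.Theory Num.Theory.
Import numFieldNormedType.Exports.
Local Open Scope classical_set_scope.
Local Open Scope ring_scope.

Section QuatNorm.
Context {R : realType}.
Implicit Types x y : quat R.

(** Under the square root this is Euler's four-square identity. *)
Lemma quat_normM x y : `|x * y| = `|x| * `|y|.
Proof.
rewrite !quat_normE -sqrtrM ?addr_ge0 ?sqr_ge0//; congr Num.sqrt.
by rewrite -[x * y]/(quat_mul x y) /quat_mul /=; ring.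
Qed.

Lemma quat_norm1 : `|1 : quat R| = 1.
Proof. by rewrite quat_normE /= !expr0n /= !addr0 expr1n sqrtr1. Qed.

Lemma quat_coord_norm_le x :
  [/\ `|q0 x| <= `|x|, `|q1 x| <= `|x|, `|q2 x| <= `|x| & `|q3 x| <= `|x|].
Proof.
rewrite quat_normE.
have := (sqr_ge0 (q0 x), sqr_ge0 (q1 x), sqr_ge0 (q2 x), sqr_ge0 (q3 x)).
by move=> [[[? ?] ?] ?]; split; rewrite -sqrtr_sqr ler_wsqrtr//; lra.
Qed.

Lemma quat_coordE x :
  x = q0 x *: 1 + q1 x *: qi + q2 x *: qj + q3 x *: qk.
Proof.
by case: x => a b c d; rewrite /GRing.scale /GRing.add /= /quat_scale /quat_add /=;
  congr Quat; ring.
Qed.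

Lemma quat_coord_continuous :
  [/\ continuous (@q0 R), continuous (@q1 R), continuous (@q2 R)
    & continuous (@q3 R)].
Proof.
split=> x; apply/(@cvgrPdist_lt _ _ _ (nbhs x) (nbhs_filter x)) => e e0;
  apply/nbhs_normP; exists e => //= y;
  by apply: le_lt_trans; have [] := quat_coord_norm_le (x - y).
Qed.

Lemma quat_coord_cauchy (F : set_system (quat R)) : ProperFilter F ->
  cauchy F -> [/\ cvg (@q0 R @ F), cvg (@q1 R @ F), cvg (@q2 R @ F)
    & cvg (@q3 R @ F)].
Proof.
move=> FF /cauchy_ballP Fc; split; apply: cauchy_cvg; apply/cauchy_ballP => e e0;
  rewrite near_map2; apply: filterS (Fc e e0) => -[x y];
  rewrite -!ball_normE /=; apply: le_lt_trans;
  by have [] := quat_coord_norm_le (x - y).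
Qed.

(** Completeness comes from that of [R]: each coordinate is 1-Lipschitz, so a Cauchy filter has
    Cauchy images in [R], and the coordinate limits are reassembled along the basis 1, i, j, k. The
    M-test needs this to obtain limits. *)
Lemma quat_cauchy_cvg (F : set_system (quat R)) : ProperFilter F ->
  cauchy F -> cvg F.
Proof.
move=> FF /quat_coord_cauchy[F0 F1 F2 F3].
have coordK : (fun x => q0 x *: 1 + q1 x *: qi + q2 x *: qj + q3 x *: qk) = id.
  by apply/funext => x; rewrite -quat_coordE.
suff : cvg ((fun x => q0 x *: 1 + q1 x *: qi + q2 x *: qj + q3 x *: qk) @ F).
  by rewrite coordK.
by apply: is_cvgD; [apply: is_cvgD; [apply: is_cvgD|]|]; apply: is_cvgZr_tmp.
Qed.

HB.instance Definition _ := Uniform_isComplete.Build (quat R) quat_cauchy_cvg.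

End QuatNorm.

Lemma weierstrass_M_test (T : choiceType) (R : realType)
    (V : completeNormedModType R) (A : set T) (f : nat -> T -> V)
    (M : nat -> R) :
  (forall n x, A x -> `|f n x| <= M n) -> cvgn (series M) ->
  {uniform A, (fun N x => series (f^~ x) N) @ \oo -->
    (fun x => limn (series (f^~ x)))}.
Proof.
move=> fM cM U /uniform_nbhs[E [+ EU]].
rewrite -entourage_ballE => -[e /= e0 eE].
near=> N; apply: EU => x Ax; apply: eE; rewrite -ball_normE /=.
have M0 n : 0 <= M n by rewrite (le_trans _ (fM n x Ax)).
have cf : cvgn (series (f^~ x)).
  apply: normed_cvg.
  exact: (@series_le_cvg _ (fun n => `|f n x|) M (fun=> normr_ge0 _) M0
    (fun n => fM n x Ax) cM).
have tailM m : series M m - series M N <= limn (series M) - series M N.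
  rewrite lerD2r; apply: nondecreasing_cvgn_le => //.
  exact: nondecreasing_series.
apply: (@le_lt_trans _ _ (limn (series M) - series M N)).
  (* The distance from the [N]-th partial sum to the limit is itself a limit over [m], so a bound
     valid for all large [m] passes to it. *)
  have cfN : `|series (f^~ x) m - series (f^~ x) N| @[m --> \oo] -->
      `|limn (series (f^~ x)) - series (f^~ x) N|.
    by apply: cvg_norm; apply: cvgB => //; exact: cvg_cst.
  rewrite -(cvg_lim (@Rhausdorff R) cfN); apply: limr_le.
    by apply/cvg_ex; eexists; exact: cfN.
  near=> m; have Nm : (N <= m)%N by near: m; exact: nbhs_infty_ge.
  apply: le_trans (tailM m); rewrite !sub_series_geq//.
  by apply: le_trans (ler_norm_sum _ _ _) _; apply: ler_sum => i _; exact: fM.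
apply: le_lt_trans (ler_norm _) _; near: N.
exact: cvgr_dist_lt.
Unshelve. all: by end_near. Qed.

(** Some tail of the roots has supremum below [rho], which gives [a n <= rho ^+ n] from some index
    on; the constant absorbs the finitely many earlier terms. *)
Lemma limn_esup_root_lt (R : realType) (a : R^nat) (rho : R) :
  (forall n, 0 <= a n) -> 0 < rho ->
  (limn_esup (fun n => (a n `^ n%:R^-1)%:E) < rho%:E)%E ->
  exists C, 0 <= C /\ forall n, a n <= C * rho ^+ n.
Proof.
move=> a0 rho0 /ereal_inf_lt[_ [V [N _ NV] <-]] Vrho.
(* Index 0 is left out: there the exponent is [0^-1 = 0], so the root equals 1 whatever [a 0] is. *)
have arho n : (maxn N 1 <= n)%N -> a n <= rho ^+ n.
  rewrite geq_max => /andP[Nn n0].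
  have : a n `^ n%:R^-1 <= rho.
    rewrite -lee_fin; apply: le_trans (ltW Vrho); apply: ereal_sup_ubound.
    by exists n => //; exact: NV.
  move=> /(@lerXn2r _ n _ _); rewrite !nnegrE powR_ge0 ltW// => /(_ isT isT).
  by rewrite -(powR_mulrn _ (powR_ge0 _ _)) -powRrM mulVf ?powRr1 // pnatr_eq0 -lt0n.
(* In [1 + S], the 1 serves the tail, and each early ratio [a k / rho ^+ k] is a summand of [S]. *)
pose S := \sum_(k < maxn N 1) a k / rho ^+ k.
have S0 k : 0 <= a k / rho ^+ k by rewrite divr_ge0// exprn_ge0// ltW.
exists (1 + S); split => [|n]; first by apply: addr_ge0 => //; apply: sumr_ge0.
have [/arho nrho|nN] := leqP (maxn N 1) n.
  apply: le_trans nrho _; rewrite ler_peMl//; first by rewrite exprn_ge0// ltW.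
  by rewrite lerDl; apply: sumr_ge0.
rewrite -ler_pdivrMr ?exprn_gt0// /S (bigD1 (Ordinal nN))//= addrCA lerDl.
by apply: addr_ge0 => //; apply: sumr_ge0.
Qed.

Section FueterBounds.
Context {R : realType}.
Implicit Types x : quat R.

Lemma norm1'_continuous : continuous (@norm1' R).
Proof.
have [_ c1 c2 c3] := @quat_coord_continuous R.
have cZA (f : quat R -> R) (a : quat R) : continuous f ->
    continuous (fun x => a * (f x)%:A).
  move=> cf x; under eq_fun do rewrite -scalerAr mulr1.
  by apply: continuousZr_tmp; exact: cf.
move=> x; apply: (@continuous_max _ _ (fun x => `|xi2 x|) (fun x => `|xi3 x|)).
  apply: (@continuous_comp _ _ _ (@xi2 R) Num.norm); last exact: norm_continuous.
  apply: continuousB; first exact: continuousZr_tmp (c2 x).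
  exact: cZA.
apply: (@continuous_comp _ _ _ (@xi3 R) Num.norm); last exact: norm_continuous.
apply: continuousB; first exact: continuousZr_tmp (c3 x).
exact: cZA.
Qed.

Lemma norm1'_ge0 x : 0 <= norm1' x.
Proof. by rewrite /norm1' le_max normr_ge0. Qed.

Lemma norm_xi_le l x : `|xi l x| <= norm1' x.
Proof. by case: l; rewrite /norm1' le_max lexx ?orbT. Qed.

Lemma norm_word_le (w : seq bool) x :
  `|\prod_(l <- w) xi l x| <= norm1' x ^+ size w.
Proof.
elim: w => [|l w IHw]; first by rewrite big_nil quat_norm1.
by rewrite big_cons quat_normM exprS ler_pM// norm_xi_le.
Qed.

(** A word is determined by the positions of its letters 2, which form an [s]-element subset of the
    [s + t] positions. *)
Lemma card_words_le (s t : nat) : (#|words s t| <= 'C(s + t, s))%N.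
Proof.
pose pos (w : (s + t).-tuple bool) := [set i | ~~ tnth w i]%SET.
have pos_inj : injective pos.
  move=> v w /setP vw; apply: eq_from_tnth => i.
  by have := vw i; rewrite !inE => /negb_inj.
rewrite -[in X in (_ <= X)%N](card_ord (s + t)) -card_draws.
rewrite -(card_imset _ pos_inj).
apply/subset_leq_card/fintype.subsetP => _ /imsetP[w + ->]; rewrite !inE => /andP[+ _].
rewrite -[X in X == s]sum1_count big_tuple => /eqP ws.
apply/eqP; apply: etrans ws; rewrite sum1dep_card.
by apply: eq_card => i; rewrite !inE; case: (tnth w i).
Qed.

Lemma norm_Snu_le s t x :
  `|Snu s t x| <= (s + t)`!%:R^-1 * 'C(s + t, s)%:R * norm1' x ^+ (s + t).
Proof.
rewrite /Snu normrZ ger0_norm ?invr_ge0// -mulrA ler_wpM2l ?invr_ge0//.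
apply: le_trans (ler_norm_sum _ _ _) _.
apply: (@le_trans _ _ (\sum_(w in words s t) norm1' x ^+ (s + t))).
  by apply: ler_sum => w _; rewrite -[in leRHS](size_tuple w) norm_word_le.
rewrite sumr_const -[leLHS]mulr_natl ler_wpM2r ?exprn_ge0 ?norm1'_ge0//.
by rewrite ler_nat card_words_le.
Qed.

(** The body copies the sum inside [sigma], so that [sigma b] is by conversion the limsup of the
    roots of this sequence. *)
Definition weighted_coef (b : nat -> nat -> quat R) (n : nat) : R :=
  \sum_(s < n.+1) 'C(n, s)%:R * `|n`!%:R^-1 *: b s (n - s)%N|.

Lemma weighted_coef_ge0 b n : 0 <= weighted_coef b n.
Proof. by apply: sumr_ge0 => s _; rewrite mulr_ge0. Qed.

Definition homogeneous_term (b : nat -> nat -> quat R) (n : nat) x : quat R :=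
  \sum_(s < n.+1) Snu s (n - s)%N x * b s (n - s)%N.

Lemma norm_homogeneous_term_le b n x :
  `|homogeneous_term b n x| <= weighted_coef b n * norm1' x ^+ n.
Proof.
apply: le_trans (ler_norm_sum _ _ _) _; rewrite mulr_suml.
apply: ler_sum => s _; rewrite quat_normM.
apply: le_trans (ler_wpM2r (normr_ge0 _) (norm_Snu_le _ _ _)) _.
(* As [s <= n], the truncated [s + (n - s)] is [n]; the factor [1/n!] of [Snu] then matches the one
   pulled out of the norm on the right. *)
rewrite subnKC -1?ltnS// normrZ ger0_norm ?invr_ge0//.
by rewrite mulrAC [_^-1 * _]mulrC -(mulrA 'C(n, s)%:R).
Qed.

Lemma sigma_ge0 (b : nat -> nat -> quat R) : (0 <= sigma b)%E.
Proof.
by apply: limf_esup_ge0 => [|n]; [exact: filter_not_empty|rewrite lee_fin powR_ge0].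
Qed.

Lemma lt_inve_exists_real (s : \bar R) (r : R) : (0 <= s)%E -> 0 <= r ->
  (r%:E < s^-1)%E -> exists rho, [/\ 0 < rho, (s < rho%:E)%E & r * rho < 1].
Proof.
(* Exchanging the inverse gives [s < r^-1] in the extended reals, which makes [s] finite and treats
   [s = 0] like any other value. *)
move=> s0 r0; rewrite inve_pgt ?inE ?lee_fin//.
case: s s0 => [s| |] // s0; last by rewrite ltNge leey.
rewrite lee_fin in s0.
have [->|rn0] := eqVneq r 0.
  (* For [r = 0] any real above [s] will do; otherwise the midpoint of [s] and [r^-1] is taken. *)
  by exists (s + 1); split; rewrite ?mul0r ?lte_fin; lra.
have {rn0}r0 : 0 < r by rewrite lt_neqAle eq_sym rn0.
have rV0 : 0 < r^-1 by rewrite invr_gt0.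
rewrite inver gt_eqF// lte_fin => sr.
exists ((s + r^-1) / 2); rewrite lte_fin -ltr_pdivlMl// mulr1.
by move: (r^-1) rV0 sr => v v0 sv; split; lra.
Qed.

End FueterBounds.

(** Convergence of [u] is not assumed: both sides choose from the same set of limits. The shift
    arises because [partial_sum b N] has [N + 1] terms while [series] at [N] has [N]. *)
Lemma limn_shiftS (T : ptopologicalType) (u : nat -> T) :
  limn (fun n => u n.+1) = limn u.
Proof.
rewrite /lim /=; congr get; apply/funext => l; rewrite propeqE.
by rewrite cvg_shiftS.
Qed.

Theorem theorem6p0p3 (R : realType) (b : nat -> nat -> quat R) :
  {family compactly_in (convergence_set b),
    (fun N : nat => partial_sum b N) @ \oo -->
    (fun x : quat R => limn (fun N : nat => partial_sum b N x))}.
Proof.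
apply/fam_cvgP => K [Kb cK].
(* The empty compact set is split off because a maximum of [norm1'] exists only on a nonempty
   one. *)
have [->|/set0P K0] := eqVneq K set0; first exact: cvg_uniform_set0.
have [c /set_mem Kc normK] :=
  compact_EVT_max K0 cK (continuous_subspaceT (@norm1'_continuous R)).
have [_ csigma] := Kb _ Kc.
have [rho [rho0 sigma_rho rrho]] :=
  lt_inve_exists_real _ _ (sigma_ge0 b) (norm1'_ge0 c) csigma.
have [C [C0 coefC]] := limn_esup_root_lt _ _ _ (weighted_coef_ge0 b) rho0 sigma_rho.
have partial_sumE N x :
    partial_sum b N x = series (homogeneous_term b ^~ x) N.+1.
  by rewrite /series /= big_mkord.
have -> : (fun x => limn (fun N => partial_sum b N x)) =
    (fun x => limn (series (homogeneous_term b ^~ x))).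
  by apply/funext => x; under eq_fun do rewrite partial_sumE; exact: limn_shiftS.
(* Writing the index shift as a composition with [S] lets uniform convergence of the series transfer
   along [S @ \oo --> \oo]. *)
have -> : (fun N => partial_sum b N) =
    (fun N x => series (homogeneous_term b ^~ x) N) \o S.
  by apply/funext => N; apply/funext => x; exact: partial_sumE.
have S_oo : S @ \oo --> \oo.
  by move=> A [N _ NA]; exists N => // n Nn; apply: NA; exact: leqW.
apply: (cvg_comp S _ S_oo).
apply: (@weierstrass_M_test _ _ _ _ _ (geometric C (norm1' c * rho))).
  move=> n x Kx; apply: le_trans (norm_homogeneous_term_le b n x) _.
  rewrite /geometric /= mulrC exprMn [C * _]mulrC -mulrA [_ ^+ n * C]mulrC.
  apply: ler_pM; rewrite ?exprn_ge0 ?norm1'_ge0 ?weighted_coef_ge0 ?coefC//.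
  by rewrite lerXn2r ?nnegrE ?norm1'_ge0 ?normK ?mem_set.
apply: is_cvg_geometric_series.
by rewrite ger0_norm ?mulr_ge0 ?norm1'_ge0 ?ltW.
Qed.
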